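(* For each pair partition $\mathfrak{m}\in\mathcal{P}_k$, with $t=1-\frac NM$, the Weingarten function has the large $N$ expansion (with $M/N=1/(1-t)$ held fixed) \[ \mathrm{Wg}^{\mathbf{A}}(\mathfrak{m})=\frac1{(1-t)^k}\sum_{r=0}^\infty \vec h^{(t)}_r(\mathfrak{m})\Big(-\frac1N\Big)^r. \]
   Context: $\mathbf{A}(M,N)$ ($M<N$) is the space of $N\times N$ real symmetric idempotent matrices of rank $M$ with its $\mathrm{O}(N)$-invariant Haar probability measure $\mathrm{d}\mu$; $A_{ij}$ is the $(i,j)$ entry. $\mathcal{P}_k$ is the set of pair partitions of $\{1,\ldots,2k\}$; $\mathfrak{e}_k=\{\{1,2\},\{3,4\},\ldots,\{2k-1,2k\}\}$. $S_{2k}$ acts on $\mathcal{P}_k$ by $\{a,b\}\in\mathfrak{m}\iff\{\sigma(a),\sigma(b)\}\in\sigma\cdot\mathfrak{m}$. $\mathrm{Wg}^{\mathbf{A}}(\mathfrak{m})=\int_{\mathbf{A}(M,N)}A_{i(1)i(2)}\cdots A_{i(2k-1)i(2k)}\,\mathrm{d}\mu$, where $i:\{1,\ldots,2k\}\to\{1,\ldots,N\}$ satisfies $i(a)=i(b)\iff\{a,b\}\in\mathfrak{m}$ for $a\ne b$. A monotone factorisation of $\mathfrak{m}\in\mathcal{P}_k$ is a sequence $\boldsymbol\tau=(\tau_1,\ldots,\tau_r)$ of transpositions $\tau_s=(a_s~b_s)\in S_{2k}$, $a_s<b_s$, with $b_1\le b_2\le\cdots\le b_r$ all odd and $\tau_1\circ\cdots\circ\tau_r\cdot\mathfrak{m}=\mathfrak{e}_k$;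 its length is $r$ and its hive number $\mathrm{hive}(\boldsymbol\tau)$ is the number of distinct values among $b_1,\ldots,b_r$. $\vec h^{(t)}_r(\mathfrak{m})\in\mathbb{Z}[t]$ is the sum of $t^{\mathrm{hive}(\boldsymbol\tau)}$ over monotone factorisations $\boldsymbol\tau$ of $\mathfrak{m}$ of length $r$. *)

(* Defs.v *)
From HB Require Import structures.
From mathcomp Require Import all_boot all_order all_algebra all_fingroup.
From mathcomp Require Import all_classical all_reals all_analysis.
From mathcomp Require Import zify.
Set Implicit Arguments. Unset Strict Implicit. Unset Printing Implicit Defensive.
Import Order.TTheory GRing.Theory Num.Theory.
Import numFieldNormedType.Exports.
Local Open Scope ring_scope.

(* Points 1..2k are represented 0-indexed by 'I_(2*k): the point p (1-indexed)
   is the ordinal of value p-1. *)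

Definition pair_partition (k : nat) (m : {set {set 'I_(2*k)}}) : bool :=
  finset.partition m [set: 'I_(2*k)] && [forall B in m, #|B| == 2%N].

Lemma ltn_fst (k : nat) (l : 'I_k) : (2 * l < 2 * k)%N.
Proof. by rewrite ltn_pmul2l. Qed.

Lemma ltn_snd (k : nat) (l : 'I_k) : ((2 * l).+1 < 2 * k)%N.
Proof. have := ltn_ord l; lia. Qed.

(* the points 2l+1 and 2l+2 (1-indexed), for l = 0..k-1 *)
Definition ofst (k : nat) (l : 'I_k) : 'I_(2*k) := Ordinal (ltn_fst l).
Definition osnd (k : nat) (l : 'I_k) : 'I_(2*k) := Ordinal (ltn_snd l).

Definition e_part (k : nat) : {set {set 'I_(2*k)}} :=
  [set [set ofst l; osnd l] | l : 'I_k].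

Definition pp_act (k : nat) (s : {perm 'I_(2*k)}) (m : {set {set 'I_(2*k)}})
  : {set {set 'I_(2*k)}} := imset (fun B : {set 'I_(2*k)} => imset s (mem B)) (mem m).

Definition transp (k : nat) (ab : 'I_(2*k) * 'I_(2*k)) : {perm 'I_(2*k)} :=
  tperm ab.1 ab.2.

Definition act_seq (k : nat) (s : seq ('I_(2*k) * 'I_(2*k)))
  (m : {set {set 'I_(2*k)}}) : {set {set 'I_(2*k)}} :=
  foldr (fun ab m' => pp_act (transp ab) m') m s.

(* monotone factorisation of m: a_s < b_s, b_1 <= ... <= b_r, all b_s odd
   (1-indexed, i.e. the 0-indexed value of b_s is even), and
   tau_1 o ... o tau_r . m = e_k *)
Definition monotone_fact (k : nat) (m : {set {set 'I_(2*k)}})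
  (s : seq ('I_(2*k) * 'I_(2*k))) : bool :=
  [&& all (fun ab : 'I_(2*k) * 'I_(2*k) => (nat_of_ord ab.1 < nat_of_ord ab.2)%N) s,
      sorted leq (map (fun ab : 'I_(2*k) * 'I_(2*k) => nat_of_ord ab.2) s),
      all (fun ab : 'I_(2*k) * 'I_(2*k) => odd (nat_of_ord ab.2).+1) s &
      act_seq s m == e_part k].

Definition hive (k : nat) (s : seq ('I_(2*k) * 'I_(2*k))) : nat :=
  size (undup (map snd s)).

Definition hpoly (k r : nat) (m : {set {set 'I_(2*k)}}) : {poly int} :=
  \sum_(s : r.-tuple ('I_(2*k) * 'I_(2*k)) | monotone_fact m s) 'X^(hive s).

Definition heval (R : realType) (k r : nat) (m : {set {set 'I_(2*k)}}) (t : R)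
  : R := (map_poly (fun z : int => z%:~R) (hpoly r m)).[t].

(* sigma-algebra on N x N real matrices generated by the entry maps
   (= the Borel sigma-algebra of R^(N*N)) *)
Definition mxR (R : realType) (N : nat) : Type := 'M[R]_N.
HB.instance Definition _ (R : realType) (N : nat) := Choice.on (mxR R N).
HB.instance Definition _ (R : realType) (N : nat) := isPointed.Build (mxR R N) 0%R.

Definition mx_entry_sets (R : realType) (N : nat) : set (set (mxR R N)) :=
  [set B | exists i j (C : set R), measurable C /\
     B = (fun A : mxR R N => (A : 'M[R]_N) i j) @^-1` C]%classic.

Notation MxSpace R N := (g_sigma_algebraType (@mx_entry_sets R N)).

Definition Aspace (R : realType) (M N : nat) : set 'M[R]_N :=
  [set A | A^T = A /\ A *m A = A /\ \rank A = M]%classic.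

Definition orthogonal_mx (R : realType) (N : nat) (O : 'M[R]_N) : Prop :=
  O *m O^T = 1%:M.

Definition haar_A (R : realType) (M N : nat)
  (mu : probability (MxSpace R N) R) : Prop :=
  mu.-negligible (~` (@Aspace R M N : set (MxSpace R N)))%classic /\
  (forall O : 'M[R]_N, orthogonal_mx O ->
     forall B : set (MxSpace R N), measurable B ->
       mu ((fun A : MxSpace R N => (O *m A *m O^T : MxSpace R N)) @^-1` B)%classic = mu B).

Definition adapted (k N : nat) (m : {set {set 'I_(2*k)}}) (i : 'I_(2*k) -> 'I_N)
  : bool := [forall a, forall b, (a != b) ==> ((i a == i b) == ([set a; b] \in m))].

Definition wg_integrand (R : realType) (k N : nat) (i : 'I_(2*k) -> 'I_N)
  (A : 'M[R]_N) : R :=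
  \prod_(l < k) A (i (ofst l)) (i (osnd l)).

(* Main.v *)
Require Import Defs.
From mathcomp Require Import all_boot all_order all_algebra all_fingroup.
From mathcomp Require Import all_classical all_reals all_analysis measurable_realfun.
From mathcomp Require Import ring lra zify.
Import Order.TTheory GRing.Theory Num.Theory.
Import numFieldNormedType.Exports.
Local Open Scope classical_set_scope.
Local Open Scope ring_scope.
Set Implicit Arguments.
Unset Strict Implicit.
Unset Printing Implicit Defensive.

(* Replace the pair partition m by a colouring c of the 2k points whose fibres
   are the pairs of m, on which transpositions act by precomposition, and let
   Phi_j(c) be the expectation of the product of the first j entries
   A_{c(1)c(2)} ... A_{c(2j-1)c(2j)}.

   Differentiating the invariance under rotations of the (p, q)-plane gives an
   exchange relation: the sum, over the points s <= 2j of colour p, of Phi_j(c)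
   with s recoloured to q is symmetric in p and q.  If x is one of the two points
   of its colour, it follows that recolouring this pair to another colour q gives
   Phi_j(c) plus the terms Phi_j(c o (a x)), for a of colour q.  Now take j + 1
   factors and x = 2j+1, and sum over q: the left-hand side is contracted by
   tr A = M or by A^2 = A to expectations of degree j, and the result is
     N W_{j+1} + J_j W_{j+1} = M W_j + J_j W_j.
   Here (J_j f)(c) is the sum of f(c o (a 2j+1)) over a <= 2j, and W_j(c) is
   Phi_j(c) if the points 2l+1 and 2l+2 have the same colour for all l >= j, and
   0 otherwise.

   Removing the last transposition of a monotone factorisation, with a factor t
   when it is the only one with b = 2j+1, gives the same recursion for the
   generating series at -1/N.  For N > 2k the operator - J_j / N is a
   contraction, so the partial sums converge to the rescaled moments, by
   induction on j. *)

Lemma mxtrace_idempotent (F : fieldType) (n : nat) (A : 'M[F]_n) :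
  A *m A = A -> \tr A = (\rank A)%:R.
Proof.
move=> AA; suff row_col1 : row_base A *m col_base A = 1%:M.
  by rewrite -[in LHS](mulmx_base A) mxtrace_mulC row_col1 mxtrace1.
apply: (row_free_inj (row_base_free A)); apply: (row_full_inj (col_base_full A)).
by rewrite mul1mx -[_ *m row_base A]mulmxA mulmxA !mulmx_base AA.
Qed.

Lemma symmetric_mxE (T : Type) (n : nat) (A : 'M[T]_n) :
  A^T = A -> forall i j, A i j = A j i.
Proof. by move=> AT i j; rewrite -[in LHS]AT mxE. Qed.

Section LinearCoefficients.

Variable R : comNzRingType.

Lemma coef1M (p q : {poly R}) : (p * q)`_1 = p`_0 * q`_1 + p`_1 * q`_0.
Proof. by rewrite coefM big_ord_recl big_ord1. Qed.

Lemma coef1_mulmx (m n l : nat) (P : 'M[{poly R}]_(m, n)) (Q : 'M[{poly R}]_(n, l)) :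
  map_mx (coefp 1) (P *m Q) =
  map_mx (coefp 0) P *m map_mx (coefp 1) Q + map_mx (coefp 1) P *m map_mx (coefp 0) Q.
Proof.
apply/matrixP => i j; rewrite !mxE raddf_sum -big_split /=; apply: eq_bigr => s _.
by rewrite coef1M !mxE.
Qed.

Lemma coef1_prod (I : finType) (P : pred I) (F : I -> {poly R}) :
  (\prod_(i | P i) F i)`_1 =
  \sum_(i | P i) (F i)`_1 * \prod_(l | P l && (l != i)) (F l)`_0.
Proof.
have [n] := ubnP #|P|; elim: n P => // n IH P Pn.
have [i Pi|P0] := pickP P; last by rewrite !big_pred0 // coefC.
rewrite (bigD1 i) //= coef1M IH; last first.
  move: Pn; rewrite (cardD1 i) [i \in P]Pi add1n ltnS; apply: leq_ltn_trans.
  by apply: subset_leq_card; apply/fintype.subsetP => l; rewrite !inE andbC.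
rewrite [RHS](bigD1 i) //= [RHS]addrC; congr (_ + _ * _); last first.
  by rewrite -horner_coef0 horner_prod; apply: eq_bigr => l _; rewrite horner_coef0.
rewrite mulr_sumr; apply: eq_bigr => l /andP[_ li]; rewrite mulrCA; congr (_ * _).
rewrite [RHS](bigD1 i) /=; last by rewrite Pi eq_sym.
by congr (_ * _); apply: eq_bigl => s; rewrite andbAC.
Qed.

End LinearCoefficients.

Lemma coef_interpolation (F : fieldType) (n : nat) (x : nat -> F) (p : {poly F}) (i : nat) :
  (0 < n)%N -> injective x -> (size p <= n)%N ->
  p`_i = \sum_(l < n) (tnth (lagrange n x) l : {poly F})`_i * p.[x l].
Proof.
move=> n_gt0 x_inj pn; rewrite {1}(lagrange_gen n_gt0 x_inj pn) coef_sum.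
by apply: eq_bigr => l _; rewrite coefCM mulrC.
Qed.

Lemma orthogonal_rodrigues (R : realType) (n : nat) (X : 'M[R]_n) (s u : R) :
  X^T = - X -> X *m X *m X = - X -> s ^+ 2 + (1 - u) ^+ 2 = 1 ->
  orthogonal_mx (1%:M + s *: X + u *: (X *m X)).
Proof.
move=> trX cubeX su; rewrite /orthogonal_mx !linearD /= !linearZ /= trmx1 trmx_mul trX.
have fourthX : X *m X *m (X *m X) = - (X *m X) by rewrite mulmxA cubeX mulNmx.
rewrite !(mulmxN, mulNmx) opprK !mulmxDl !mul1mx !mulmx1 -!scalemxAl.
rewrite [X *m (X *m X)]mulmxA cubeX fourthX.
have sqr_s : s * s = 2 * u - u * u by move: su; rewrite !expr2; lra.
by apply/matrixP => i j; rewrite !mxE; ring: sqr_s.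
Qed.

Section PlaneRotation.

Variables (R : nzRingType) (n : nat) (p q : 'I_n).

Definition plane_gen : 'M[R]_n := delta_mx p q - delta_mx q p.

Lemma tr_plane_gen : plane_gen^T = - plane_gen.
Proof. by rewrite linearB /= !trmx_delta opprB. Qed.

Lemma plane_gen_cube : p != q -> plane_gen *m plane_gen *m plane_gen = - plane_gen.
Proof.
move=> /negbTE pq; have qp : (q == p) = false by rewrite eq_sym.
have -> : plane_gen *m plane_gen = - (delta_mx p p + delta_mx q q).
  rewrite /plane_gen mulmxBl !mulmxBr !mul_delta_mx_cond !eqxx pq qp.
  by rewrite !(mulr0n, mulr1n) sub0r subr0 opprD.
rewrite mulNmx mulmxDl /plane_gen !mulmxBr !mul_delta_mx_cond !eqxx pq qp.
by rewrite !(mulr0n, mulr1n) sub0r subr0.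
Qed.

Lemma plane_gen_mulE (A : 'M[R]_n) (r s : 'I_n) :
  (plane_gen *m A) r s = A q s *+ (r == p) - A p s *+ (r == q).
Proof.
have deltaE u v : (delta_mx u v *m A) r s = A v s *+ (r == u).
  rewrite -(mul_delta_mx (0 : 'I_1)) -mulmxA -rowE mxE big_ord1 !mxE andbT.
  by rewrite mulr_natl.
by rewrite mulmxBl [LHS]mxE [X in _ + X]mxE !deltaE.
Qed.

End PlaneRotation.

Section BoundedMeasurable.

Variables (d : measure_display) (T : measurableType d) (R : realType) (D : set T).
Implicit Types f g : T -> R.

Definition bounded_mfun f : Prop :=
  measurable_fun setT f /\ exists C, forall x, D x -> `|f x| <= C.

Lemma bounded_mfun_cst (a : R) : bounded_mfun (fun=> a).
Proof. by split; [exact: measurable_cst | exists `|a|]. Qed.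

Lemma bounded_mfunD f g : bounded_mfun f -> bounded_mfun g -> bounded_mfun (f + g).
Proof.
move=> [mf [C fC]] [mg [C' gC']]; split; first exact: measurable_funD.
exists (C + C') => x Dx; apply: le_trans (ler_normD _ _) _.
by apply: lerD; [exact: fC | exact: gC'].
Qed.

Lemma bounded_mfunM f g : bounded_mfun f -> bounded_mfun g -> bounded_mfun (f * g).
Proof.
move=> [mf [C fC]] [mg [C' gC']]; split; first exact: measurable_funM.
by exists (C * C') => x Dx; rewrite normrM; apply: ler_pM; [| |exact: fC|exact: gC'].
Qed.

Lemma bounded_mfun_sum (I : Type) (r : seq I) (P : pred I) (F : I -> T -> R) :
  (forall i, P i -> bounded_mfun (F i)) ->
  bounded_mfun (fun x => \sum_(i <- r | P i) F i x).
Proof.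
move=> bF; rewrite -fct_sumE; elim/big_ind: _ => //; first exact: bounded_mfun_cst.
exact: bounded_mfunD.
Qed.

Lemma bounded_mfun_prod (I : Type) (r : seq I) (P : pred I) (F : I -> T -> R) :
  (forall i, P i -> bounded_mfun (F i)) ->
  bounded_mfun (fun x => \prod_(i <- r | P i) F i x).
Proof.
move=> bF; rewrite -fct_prodE; elim/big_ind: _ => //; first exact: bounded_mfun_cst.
exact: bounded_mfunM.
Qed.

Variable mu : probability T R.
Hypothesis aeD : {ae mu, forall x, D x}.

Lemma bounded_mfun_integrable f : bounded_mfun f -> mu.-integrable setT (EFin \o f).
Proof.
move=> [mf [C fC]]; apply/integrableP; split; first exact/measurable_EFinP.
apply: (@le_lt_trans _ _ (\int[mu]_(x in setT) (cst `|C|%:E) x)%E).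
  apply: ae_ge0_le_integral => //.
  - by apply: measurableT_comp => //; exact/measurable_EFinP.
  - by move=> x _; rewrite /= lee_fin.
  - apply: (@filterS _ _ (ae_filter_ringOfSetsType mu) _ _ _ aeD) => x Dx _ /=.
    by rewrite lee_fin; exact: le_trans (fC x Dx) (ler_norm _).
by rewrite integral_cst // [X in (_ * X)%E](probability_setT mu) mule1 ltry.
Qed.

Lemma ae_eq_Rintegral f g : bounded_mfun f -> bounded_mfun g ->
  (forall x, D x -> f x = g x) -> \int[mu]_x f x = \int[mu]_x g x.
Proof.
move=> [mf _] [mg _] fg; congr fine; apply: ae_eq_integral => //.
- exact/measurable_EFinP.
- exact/measurable_EFinP.
- by apply: (@filterS _ _ (ae_filter_ringOfSetsType mu) _ _ _ aeD) => x Dx _; rewrite fg.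
Qed.

Lemma Rintegral_probability_cst (a : R) : \int[mu]_x a = a.
Proof. by rewrite Rintegral_cst // [X in fine X](probability_setT mu) mulr1. Qed.

Lemma bounded_RintegralZl (a : R) f : bounded_mfun f ->
  \int[mu]_x (a * f x) = a * \int[mu]_x f x.
Proof. by move=> bf; rewrite RintegralZl //; exact: bounded_mfun_integrable. Qed.

Lemma bounded_Rintegral_sum (I : Type) (r : seq I) (P : pred I) (F : I -> T -> R) :
  (forall i, bounded_mfun (F i)) ->
  \int[mu]_x (\sum_(i <- r | P i) F i x) = \sum_(i <- r | P i) \int[mu]_x F i x.
Proof.
move=> bF; have intF i := bounded_mfun_integrable (bF i).
rewrite /Rintegral sum_fine => [|i _]; last first.
  exact: (integrable_fin_num measurableT (intF i)).
rewrite -integral_sum //; congr fine.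
by apply: eq_integral => x _; rewrite -sumEFin.
Qed.

Lemma bounded_Rintegral_coef (n i : nat) (p : T -> {poly R}) (q : {poly R}) :
  (forall x, size (p x) <= n)%N -> (forall a, bounded_mfun (fun x => (p x).[a])) ->
  (forall a, \int[mu]_x (p x).[a] = q.[a]) -> \int[mu]_x (p x)`_i = q`_i.
Proof.
move=> size_p bp pq; pose l := (maxn n (size q)).+1.
have nat_inj : injective (fun m : nat => m%:R : R).
  by move=> m m' /eqP; rewrite eqr_nat => /eqP.
have ql : (size q <= l)%N by rewrite leqW // leq_maxr.
rewrite (coef_interpolation i (ltn0Sn _) nat_inj ql).
under eq_Rintegral => x _.
  rewrite (coef_interpolation i (ltn0Sn _) nat_inj (_ : size (p x) <= l)%N); last first.
    by rewrite leqW // (leq_trans (size_p x)) ?leq_maxl.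
  over.
rewrite bounded_Rintegral_sum => [|m]; last first.
  by apply: bounded_mfunM; [exact: bounded_mfun_cst | exact: bp].
by apply: eq_bigr => m _; rewrite bounded_RintegralZl ?pq.
Qed.

End BoundedMeasurable.

Local Notation bounded M N := (@bounded_mfun _ (MxSpace _ N) _ (@Aspace _ M N)).

Section HaarProjections.

Variables (R : realType) (M N : nat).

Lemma Aspace_entry_le1 (A : 'M[R]_N) (i j : 'I_N) : Aspace M A -> `|A i j| <= 1.
Proof.
move=> [AT [AA _]].
have row_norm u : \sum_v A u v ^+ 2 = A u u.
  rewrite -[in RHS]AA mxE; apply: eq_bigr => v _.
  by rewrite expr2 -{2}AT mxE.
have sqr_le u v : A u v ^+ 2 <= A u u.
  by rewrite -row_norm (bigD1 v) //= lerDl sumr_ge0 // => w _; rewrite sqr_ge0.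
have diag_le1 : A i i <= 1 by have := sqr_le i i; have := sqr_ge0 (A i i); nra.
rewrite -(@expr_le1 _ 2) // real_normK ?num_real //.
exact: le_trans (sqr_le i j) diag_le1.
Qed.

Lemma bounded_mfun_entry (i j : 'I_N) : bounded M N (fun A => (A : 'M[R]_N) i j).
Proof.
split; last by exists 1 => A; exact: Aspace_entry_le1.
by move=> _ C mC; rewrite setTI; apply: sub_sigma_algebra; exists i, j, C.
Qed.

Definition conj_mx (U : 'M[R]_N) (A : MxSpace R N) : MxSpace R N := U *m A *m U^T.

Lemma Aspace_conj (U A : 'M[R]_N) :
  orthogonal_mx U -> Aspace M A -> Aspace M (conj_mx U A : 'M[R]_N).
Proof.
move=> orthU [AT [AA rA]]; have trUU : U^T *m U = 1%:M by exact: mulmx1C.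
have [unitU _] := mulmx1_unit orthU; split; first by rewrite !trmx_mul trmxK AT mulmxA.
split; last first.
  rewrite mxrankMfree ?row_free_unit ?unitmx_tr // -mxrank_tr trmx_mul.
  by rewrite mxrankMfree ?row_free_unit ?unitmx_tr // mxrank_tr.
by rewrite /conj_mx -!mulmxA (mulmxA U^T) trUU mul1mx (mulmxA A) AA.
Qed.

Lemma measurable_conj_mx (U : 'M[R]_N) : measurable_fun setT (conj_mx U).
Proof.
apply: (@measurability _ _ _ _ _ (conj_mx U) (@mx_entry_sets R N) erefl).
move=> _ [_ [i [j [C [mC ->]]]] <-].
have [mf _] : bounded M N (fun A => \sum_v (\sum_u U i u * (A : 'M[R]_N) u v) * U j v).
  apply: bounded_mfun_sum => v _.
  apply: bounded_mfunM (bounded_mfun_cst _ _); apply: bounded_mfun_sum => u _.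
  exact: bounded_mfunM (bounded_mfun_cst _ _) (bounded_mfun_entry _ _).
have := mf measurableT C mC; congr measurable; congr (_ `&` _); apply/funext => A /=.
by congr C; rewrite mxE; apply: eq_bigr => v _; rewrite !mxE.
Qed.

Lemma bounded_mfun_conj (U : 'M[R]_N) (f : MxSpace R N -> R) :
  orthogonal_mx U -> bounded M N f -> bounded M N (f \o conj_mx U).
Proof.
move=> orthU [mf [C fC]]; split.
  by apply: measurableT_comp => //; exact: measurable_conj_mx.
by exists C => A projA; apply: fC; exact: Aspace_conj.
Qed.

Definition entry_monomial (I : finType) (P : pred I) (a b : I -> 'I_N)
  (A : MxSpace R N) : R := \prod_(i | P i) (A : 'M[R]_N) (a i) (b i).

Lemma bounded_mfun_monomial (I : finType) (P : pred I) (a b : I -> 'I_N) :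
  bounded M N (entry_monomial P a b).
Proof. by apply: bounded_mfun_prod => i _; exact: bounded_mfun_entry. Qed.

Variable mu : probability (MxSpace R N) R.
Hypothesis haar : haar_A M mu.

Lemma haar_ae : {ae mu, forall A, @Aspace R M N A}.
Proof. by case: haar. Qed.

Lemma Rintegral_conj (U : 'M[R]_N) (f : MxSpace R N -> R) :
  orthogonal_mx U -> bounded M N f -> \int[mu]_A f (conj_mx U A) = \int[mu]_A f A.
Proof.
move=> orthU bf; congr fine.
have mU := measurable_conj_mx U.
transitivity (\int[pushforward mu (conj_mx U)]_A (f A)%:E)%E.
  rewrite (@integral_pushforward _ _ _ _ _ _ mU mu setT (EFin \o f)) //.
    by apply/measurable_EFinP; case: bf.
  rewrite preimage_setT.
  exact: (bounded_mfun_integrable haar_ae (bounded_mfun_conj orthU bf)).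
apply: (@eq_measure_integral _ _ _ setT mu) => // B mB _.
by have [_ /(_ U orthU B mB)] := haar.
Qed.

End HaarProjections.

Section InfinitesimalInvariance.

Variables (R : realType) (M N : nat) (X : 'M[R]_N).

Hypotheses (trX : X^T = - X) (cubeX : X *m X *m X = - X).

(* With tan (theta / 2) = x / 2, the rotation exp (theta X) = 1 + sin theta X +
   (1 - cos theta) X^2 has denominator 1 + x^2 / 4; these are the numerators. *)
Definition rotation_poly : 'M[{poly R}]_N :=
  \matrix_(i, j) Poly [:: (i == j)%:R; X i j; (i == j)%:R / 4 + (X *m X) i j / 2].

Lemma rotation_poly_orthogonal (x : R) : exists2 U, orthogonal_mx U &
  map_mx (horner_eval x) rotation_poly = (1 + x ^+ 2 / 4) *: U.
Proof.
have x_neq0 : 4 + x ^+ 2 != 0 by rewrite gt_eqF // ltr_wpDr ?sqr_ge0.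
exists (1%:M + (x / (1 + x ^+ 2 / 4)) *: X +
  (x ^+ 2 / 2 / (1 + x ^+ 2 / 4)) *: (X *m X)).
  by apply: orthogonal_rodrigues => //; field.
rewrite /rotation_poly; move: (X *m X) => X2; apply/matrixP => i j.
by rewrite !mxE /horner_eval horner_Poly /=; field.
Qed.

Definition conj_rotation_poly (A : 'M[R]_N) : 'M[{poly R}]_N :=
  rotation_poly *m map_mx polyC A *m rotation_poly^T.

Lemma size_conj_rotation_poly (A : 'M[R]_N) (i j : 'I_N) :
  (size (conj_rotation_poly A i j) <= 5)%N.
Proof.
have size_rot r s : (size (rotation_poly r s) <= 3)%N by rewrite mxE size_Poly.
have sizeM (p q : {poly R}) m n :
    (size p <= m)%N -> (size q <= n)%N -> (size (p * q)%R <= (m + n).-1)%N.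
  by move=> pm qn; apply: leq_trans (size_polyMleq _ _) _; lia.
rewrite mxE (leq_trans (size_sum _ _ _)) //; apply/bigmax_leqP => v _.
rewrite [_^T _ _]mxE; apply: (@sizeM _ _ 3 3) => //.
rewrite mxE (leq_trans (size_sum _ _ _)) //; apply/bigmax_leqP => u _.
by apply: (@sizeM _ _ 3 1) => //; rewrite mxE size_polyC leq_b1.
Qed.

Lemma coef0_rotation_poly : map_mx (coefp 0) rotation_poly = 1%:M.
Proof. by apply/matrixP => i j; rewrite !mxE /coefp coef_Poly. Qed.

Lemma coef0_map_polyC (A : 'M[R]_N) : map_mx (coefp 0) (map_mx polyC A) = A.
Proof. by apply/matrixP => i j; rewrite !mxE /coefp coefC. Qed.

Lemma coef0_conj_rotation_poly (A : 'M[R]_N) : map_mx (coefp 0) (conj_rotation_poly A) = A.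
Proof.
rewrite !map_mxM -map_trmx coef0_rotation_poly coef0_map_polyC.
by rewrite trmx1 mulmx1 mul1mx.
Qed.

Lemma coef1_conj_rotation_poly (A : 'M[R]_N) :
  map_mx (coefp 1) (conj_rotation_poly A) = X *m A + A *m X^T.
Proof.
have rot1 : map_mx (coefp 1) rotation_poly = X.
  by apply/matrixP => i j; rewrite !mxE /coefp coef_Poly.
have cst1 : map_mx (coefp 1) (map_mx polyC A) = 0.
  by apply/matrixP => i j; rewrite !mxE /coefp coefC.
rewrite !coef1_mulmx !map_mxM -!map_trmx coef0_rotation_poly coef0_map_polyC rot1 cst1.
by rewrite trmx1 mulmx0 add0r mulmx1 mul1mx addrC.
Qed.

Lemma coef1_prod_conj_rotation_poly (I : finType) (P : pred I) (a b : I -> 'I_N) A :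
  (\prod_(i | P i) conj_rotation_poly A (a i) (b i))`_1 =
  \sum_(i | P i) (X *m A + A *m X^T) (a i) (b i) *
                     entry_monomial [pred l | P l && (l != i)] a b A.
Proof.
have coef0 r s : (conj_rotation_poly A r s)`_0 = A r s.
  by have /matrixP/(_ r s) := coef0_conj_rotation_poly A; rewrite mxE.
have coef1 r s : (conj_rotation_poly A r s)`_1 = (X *m A + A *m X^T) r s.
  by have /matrixP/(_ r s) := coef1_conj_rotation_poly A; rewrite mxE.
rewrite coef1_prod; apply: eq_bigr => i _; rewrite coef1; congr (_ * _).
by apply: eq_bigr => l _; rewrite coef0.
Qed.

Lemma horner_conj_rotation_poly (x : R) : exists2 U, orthogonal_mx U &
  forall A, map_mx (horner_eval x) (conj_rotation_poly A) =
            (1 + x ^+ 2 / 4) ^+ 2 *: conj_mx U A.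
Proof.
have [U orthU rotE] := rotation_poly_orthogonal x; exists U => // A.
have cstE : map_mx (horner_eval x) (map_mx polyC A) = A.
  by apply/matrixP => i j; rewrite !mxE /horner_eval hornerC.
rewrite !map_mxM -map_trmx rotE cstE linearZ /= -scalemxAr -!scalemxAl scalerA.
by rewrite -expr2.
Qed.

Variable mu : probability (MxSpace R N) R.
Hypothesis haar : haar_A M mu.

(* This is the derivative at theta = 0 of the moment conjugated by
   exp (theta X), read off as the coefficient of x in an identity of polynomials. *)
Lemma haar_infinitesimal_invariance (I : finType) (P : pred I) (a b : I -> 'I_N) :
  \int[mu]_A (\sum_(i | P i) (X *m (A : 'M[R]_N) + (A : 'M[R]_N) *m X^T) (a i) (b i) *
                 entry_monomial [pred l | P l && (l != i)] a b A) = 0.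
Proof.
have bounded_monomial := bounded_mfun_monomial R M P a b.
pose p (A : MxSpace R N) := \prod_(i | P i) conj_rotation_poly A (a i) (b i).
pose q : {poly R} :=
  ((\int[mu]_A entry_monomial P a b A) *: (1 + 4^-1 *: 'X) ^+ (2 * #|P|)) \Po 'X^2.
have horner_p x : exists2 U, orthogonal_mx U & forall A,
    (p A).[x] = (1 + x ^+ 2 / 4) ^+ (2 * #|P|) * entry_monomial P a b (conj_mx U A).
  have [U orthU conjE] := horner_conj_rotation_poly x; exists U => // A.
  rewrite horner_prod exprM -prodr_const -big_split /=; apply: eq_bigr => i _.
  by have /matrixP/(_ (a i) (b i)) := conjE A; rewrite !mxE.
have bounded_p x : bounded M N (fun A => (p A).[x]).
  have [U orthU pE] := horner_p x; under eq_fun do rewrite pE.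
  apply: bounded_mfunM (bounded_mfun_cst _ _) _.
  exact: (bounded_mfun_conj orthU bounded_monomial).
have int_p x : \int[mu]_A (p A).[x] = q.[x].
  have [U orthU pE] := horner_p x; under eq_Rintegral do rewrite pE.
  rewrite (bounded_RintegralZl (haar_ae haar)); last first.
    exact: (bounded_mfun_conj orthU bounded_monomial).
  rewrite (Rintegral_conj haar orthU bounded_monomial).
  by rewrite horner_comp !hornerE /= [LHS]mulrC; congr (_ * _ ^+ _); field.
have size_p A : (size (p A) <= (\sum_(i | P i) 5).+1)%N.
  rewrite (leq_trans (size_prod_leq _ _)) // (leq_trans (leq_subr _ _)) // ltnS.
  by apply: leq_sum => i _; exact: size_conj_rotation_poly.
have := bounded_Rintegral_coef (haar_ae haar) 1 size_p bounded_p int_p.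
rewrite coef_comp_poly_Xn //= => int_p1; rewrite -[RHS]int_p1.
by apply: eq_Rintegral => A _; rewrite coef1_prod_conj_rotation_poly.
Qed.

End InfinitesimalInvariance.

Local Notation point k := 'I_(2 * k).
Local Notation transposition k := (point k * point k)%type.

Section Points.

Variable k : nat.

Lemma ofst_inj : injective (@ofst k).
Proof. by move=> l l' /(congr1 val) /= eq_val; apply: val_inj => /=; lia. Qed.

Lemma osnd_inj : injective (@osnd k).
Proof. by move=> l l' /(congr1 val) /= eq_val; apply: val_inj => /=; lia. Qed.

Lemma ofst_neq_osnd (l l' : 'I_k) : (ofst l == osnd l') = false.
Proof. by apply/negP => /eqP /(congr1 val) /=; lia. Qed.

Lemma osnd_neq_ofst (l l' : 'I_k) : (osnd l == ofst l') = false.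
Proof. by rewrite eq_sym ofst_neq_osnd. Qed.

Lemma point_block_subproof (s : point k) : (s./2 < k)%N.
Proof. by have := ltn_ord s; lia. Qed.

Definition point_block (s : point k) : 'I_k := Ordinal (point_block_subproof s).

Lemma point_blockP (s : point k) (l : 'I_k) :
  (point_block s == l) = (s == ofst l) || (s == osnd l).
Proof. by rewrite -!(inj_eq val_inj) /=; lia. Qed.

Lemma point_cases (s : point k) : exists l : 'I_k, s = ofst l \/ s = osnd l.
Proof.
exists (point_block s); have := point_blockP s (point_block s).
by rewrite eqxx => /esym/orP[]/eqP; [left | right].
Qed.

Lemma ltn_point_neq (j : 'I_k) (s : point k) :
  (s < 2 * j)%N -> (s == ofst j = false) * (s == osnd j = false).
Proof. by move=> sj; split; rewrite -(inj_eq val_inj) /=; lia. Qed.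

Lemma ltn_pointS (j : 'I_k) (s : point k) :
  (s < 2 * j.+1)%N = [|| (s < 2 * j)%N, s == ofst j | s == osnd j].
Proof. by rewrite -!(inj_eq val_inj) /=; lia. Qed.

Lemma sum_points (V : nmodType) (j : nat) (F : point k -> V) :
  \sum_(s : point k | (s < 2 * j)%N) F s =
  \sum_(l < k | (l < j)%N) (F (ofst l) + F (osnd l)).
Proof.
rewrite (partition_big point_block (fun l : 'I_k => (l < j)%N)) /= => [|s]; last by lia.
apply: eq_bigr => l lj; rewrite (bigD1 (ofst l)) /=; last first.
  by rewrite point_blockP eqxx; lia.
rewrite (bigD1 (osnd l)) /=; last by rewrite point_blockP osnd_neq_ofst eqxx; lia.
rewrite big_pred0 ?addr0 // => s; rewrite point_blockP.
by case: eqP; case: eqP; rewrite ?andbF.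
Qed.

End Points.

Section Moments.

Variables (R : realType) (k M N : nat).
Implicit Types (c : point k -> 'I_N) (A : MxSpace R N).

Definition entry_prod (j : nat) c : MxSpace R N -> R :=
  entry_monomial [pred l : 'I_k | (l < j)%N] (c \o @ofst k) (c \o @osnd k).

Lemma bounded_mfun_entry_prod j c : bounded M N (entry_prod j c).
Proof. exact: bounded_mfun_monomial. Qed.

Lemma eq_entry_prod j c c' :
  (forall s : point k, (s < 2 * j)%N -> c s = c' s) -> entry_prod j c = entry_prod j c'.
Proof.
move=> cc'; apply/funext => A; apply: eq_bigr => l /= lj.
by rewrite !cc' //=; lia.
Qed.

Lemma entry_prodS (j : 'I_k) c A :
  entry_prod j.+1 c A = (A : 'M[R]_N) (c (ofst j)) (c (osnd j)) * entry_prod j c A.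
Proof.
rewrite /entry_prod /entry_monomial (bigD1 j) //=; congr (_ * _); apply: eq_bigl => l.
by rewrite ltnS -(inj_eq val_inj) /= (ltn_neqAle l j) andbC.
Qed.

Section Update.

Variables (j : nat) (l : 'I_k) (c : point k -> 'I_N) (r : 'I_N) (A : MxSpace R N).
Hypothesis lj : (l < j)%N.

Let others := entry_monomial [pred i : 'I_k | (i < j)%N && (i != l)]
  (c \o @ofst k) (c \o @osnd k) A.

Lemma entry_prod_update_ofst :
  entry_prod j [eta c with ofst l |-> r] A = (A : 'M[R]_N) r (c (osnd l)) * others.
Proof.
rewrite /entry_prod /entry_monomial (bigD1 l) //= eqxx osnd_neq_ofst.
congr (_ * _); apply: eq_bigr => i /andP[_ /negbTE il].
by rewrite /= (inj_eq (@ofst_inj _)) il osnd_neq_ofst.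
Qed.

Lemma entry_prod_update_osnd :
  entry_prod j [eta c with osnd l |-> r] A = (A : 'M[R]_N) (c (ofst l)) r * others.
Proof.
rewrite /entry_prod /entry_monomial (bigD1 l) //= eqxx ofst_neq_osnd.
congr (_ * _); apply: eq_bigr => i /andP[_ /negbTE il].
by rewrite /= (inj_eq (@osnd_inj _)) il ofst_neq_osnd.
Qed.

End Update.

Lemma entry_prod_update j c (s : point k) A : (A : 'M[R]_N)^T = A -> (s < 2 * j)%N ->
  exists r others,
    forall q, entry_prod j [eta c with s |-> q] A = (A : 'M[R]_N) q r * others.
Proof.
move=> /symmetric_mxE symA; have [l [->|->]] := point_cases s => /= lj.
  exists (c (osnd l)); eexists => q; apply: entry_prod_update_ofst; lia.
exists (c (ofst l)); eexists => q; rewrite (symA q); apply: entry_prod_update_osnd; lia.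
Qed.

Lemma sum_plane_gen_entry_prod j c (p q : 'I_N) A :
  \sum_(l < k | (l < j)%N)
    (plane_gen R p q *m (A : 'M[R]_N) + (A : 'M[R]_N) *m (plane_gen R p q)^T)
      (c (ofst l)) (c (osnd l)) *
    entry_monomial [pred i : 'I_k | (i < j)%N && (i != l)] (c \o @ofst k) (c \o @osnd k) A =
  \sum_(s : point k | (s < 2 * j)%N && (c s == p)) entry_prod j [eta c with s |-> q] A -
  \sum_(s : point k | (s < 2 * j)%N && (c s == q)) entry_prod j [eta c with s |-> p] A.
Proof.
rewrite !big_mkcondr -sumrB sum_points; apply: eq_bigr => l lj.
rewrite !entry_prod_update_ofst // !entry_prod_update_osnd //.
have -> : (A : 'M[R]_N) *m (plane_gen R p q)^T = (plane_gen R p q *m (A : 'M[R]_N)^T)^T.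
  by rewrite trmx_mul trmxK.
rewrite [in LHS]mxE [X in _ + X]mxE !plane_gen_mulE ![_^T _ _]mxE.
by do 4 case: ifP => _; rewrite !(mulr0n, mulr1n); ring.
Qed.

Variable mu : probability (MxSpace R N) R.
Hypothesis haar : haar_A M mu.

Definition moment (j : nat) c : R := \int[mu]_A entry_prod j c A.

Lemma eq_moment j c c' :
  (forall s : point k, (s < 2 * j)%N -> c s = c' s) -> moment j c = moment j c'.
Proof. by rewrite /moment => /eq_entry_prod ->. Qed.

Lemma moment_exchange j c (p q : 'I_N) :
  \sum_(s : point k | (s < 2 * j)%N && (c s == p)) moment j [eta c with s |-> q] =
  \sum_(s : point k | (s < 2 * j)%N && (c s == q)) moment j [eta c with s |-> p].
Proof.
have [->//|pq] := eqVneq p q.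
have bprod r s := bounded_mfun_entry_prod j [eta c with s |-> r].
have bsum (P : pred (point k)) r :
    bounded M N (fun A => \sum_(s | P s) entry_prod j [eta c with s |-> r] A).
  by apply: bounded_mfun_sum => s _; exact: bprod.
have intsum P r := bounded_mfun_integrable (haar_ae haar) (bsum P r).
rewrite -!(bounded_Rintegral_sum (haar_ae haar)) //.
apply/eqP; rewrite -subr_eq0 -RintegralB //; apply/eqP.
rewrite -[RHS](haar_infinitesimal_invariance (tr_plane_gen R p q) (plane_gen_cube R pq)
  haar [pred l : 'I_k | (l < j)%N] (c \o @ofst k) (c \o @osnd k)).
by apply: eq_Rintegral => A _; rewrite sum_plane_gen_entry_prod.
Qed.

End Moments.

Section Pairings.

Variables (k : nat) (T : eqType).
Implicit Types (c : point k -> T) (a b : point k).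

Definition partner c a b : Prop :=
  b != a /\ forall s, (c s == c a) = (s == a) || (s == b).

Definition pairing c : Prop := forall a, exists b, partner c a b.

Definition matched_from (j : nat) c : bool :=
  [forall l : 'I_k, (j <= l)%N ==> (c (ofst l) == c (osnd l))].

Lemma pairing_perm c (s : {perm point k}) : pairing c -> pairing (c \o s).
Proof.
move=> pc a; have [b [ba hb]] := pc (s a).
exists ((s^-1)%g b); split; first by apply: contra_neq ba => <-; rewrite permKV.
by move=> u; rewrite /= hb (inj_eq perm_inj) (can2_eq (permK s) (permKV s)).
Qed.

Lemma partner_colour c a b : partner c a b -> c b = c a.
Proof. by case=> _ fibre; apply/eqP; rewrite fibre eqxx orbT. Qed.

Lemma matched_fromP j c :
  reflect (forall l : 'I_k, (j <= l)%N -> c (ofst l) = c (osnd l)) (matched_from j c).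
Proof.
apply: (iffP forallP) => matched_c l; first by move/implyP: (matched_c l) => /[apply]/eqP.
by apply/implyP => /matched_c ->.
Qed.

Lemma matched_from_all c : matched_from k c.
Proof. by apply/matched_fromP => l; rewrite leqNgt ltn_ord. Qed.

Lemma matched_fromS (j : 'I_k) c :
  matched_from j c = (c (ofst j) == c (osnd j)) && matched_from j.+1 c.
Proof.
apply/matched_fromP/andP => [matched_c|[/eqP cj /matched_fromP matched_c] l].
  split; first by rewrite matched_c.
  by apply/matched_fromP => l jl; apply: matched_c; exact: ltnW.
by rewrite leq_eqVlt => /predU1P[/val_inj <-|]; [|exact: matched_c].
Qed.

Lemma matched_from_tperm j c a b : (a < 2 * j)%N -> (b < 2 * j)%N ->
  matched_from j (c \o tperm a b) = matched_from j c.
Proof.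
move=> aj bj; apply: eq_forallb => l; case: (leqP j l) => //= jl.
by rewrite !tpermD // -(inj_eq val_inj) /=; lia.
Qed.

Lemma partner_lt j c a b :
  matched_from j c -> partner c a b -> (a < 2 * j)%N -> (b < 2 * j)%N.
Proof.
move=> /matched_fromP matched_c pab aj; rewrite ltnNge; apply/negP => bj.
have no_third (s : point k) : c s = c b -> s != b -> (2 * j <= s)%N -> False.
  have [_ fibre] := pab; move=> cs sb js; have := fibre s.
  rewrite cs (partner_colour pab) eqxx (negbTE sb) orbF => /esym/eqP sa.
  by move: js; rewrite sa; lia.
have [l [eb|eb]] := point_cases b; rewrite eb /= in bj.
  by apply: (no_third (osnd l)); rewrite ?eb ?osnd_neq_ofst ?matched_c //=; lia.
by apply: (no_third (ofst l)); rewrite ?eb ?ofst_neq_osnd ?matched_c //=; lia.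
Qed.

Lemma partner_ofst_lt (j : 'I_k) c b : matched_from j.+1 c ->
  c (ofst j) != c (osnd j) -> partner c (ofst j) b -> (b < 2 * j)%N.
Proof.
move=> matched_c cj pb; have [/negbTE b_neq _] := pb.
have : (b < 2 * j.+1)%N by apply: partner_lt pb _ => //=; lia.
rewrite ltn_pointS b_neq => /orP[//|/eqP eb].
by move: cj; rewrite -eb (partner_colour pb) eqxx.
Qed.

Lemma partner_osnd_lt (j : 'I_k) c b : matched_from j.+1 c ->
  c (ofst j) != c (osnd j) -> partner c (osnd j) b -> (b < 2 * j)%N.
Proof.
move=> matched_c cj pb; have [/negbTE b_neq _] := pb.
have : (b < 2 * j.+1)%N by apply: partner_lt pb _ => //=; lia.
rewrite ltn_pointS b_neq orbF => /orP[//|/eqP eb].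
by move: cj; rewrite -eb (partner_colour pb) eqxx.
Qed.

Lemma matched_from_tperm_ofst (j : 'I_k) c a : (a < 2 * j)%N ->
  matched_from j (c \o tperm a (ofst j)) = (c a == c (osnd j)) && matched_from j.+1 c.
Proof.
move=> aj; rewrite matched_fromS matched_from_tperm /=; [|lia|lia].
by rewrite tpermR tpermD // ?ofst_neq_osnd // (ltn_point_neq aj).
Qed.

End Pairings.

(* Acts on functions of a colouring as the odd Jucys--Murphy element
   (1 2j+1) + ... + (2j 2j+1) does. *)
Definition jucys_murphy (V : nmodType) (k : nat) (T : Type) (j : 'I_k)
    (f : (point k -> T) -> V) (c : point k -> T) : V :=
  \sum_(a : point k | (a < 2 * j)%N) f (c \o tperm a (ofst j)).

Lemma jucys_murphy_norm_le (R : numDomainType) (k : nat) (T : Type) (j : 'I_k)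
    (f : (point k -> T) -> R) (c : point k -> T) :
  `|jucys_murphy j f c| <= \sum_a `|f (c \o tperm a (ofst j))|.
Proof.
rewrite (le_trans (ler_norm_sum _ _ _)) // big_mkcond ler_sum // => a _.
by case: ifP.
Qed.

Section MomentRecursion.

Variables (R : realType) (k M N : nat) (mu : probability (MxSpace R N) R).
Hypothesis haar : haar_A M mu.
Implicit Types (c : point k -> 'I_N).

Local Notation moment := (@moment R k N mu).

Lemma moment_recolour j c (x y : point k) (q : 'I_N) :
  (x < 2 * j)%N -> (y < 2 * j)%N -> partner c x y ->
  moment j [eta c with x |-> q, y |-> q] = moment j c +
    \sum_(a : point k | [&& (a < 2 * j)%N, c a != c x & c a == q])
      moment j (c \o tperm a x).
Proof.
move=> xj yj pxy; have [yx fibre] := pxy; have cy := partner_colour pxy.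
have [->|qx] := eqVneq q (c x).
  rewrite big_pred0 ?addr0 => [|a]; last by case: (c a == c x); rewrite !andbF.
  apply: eq_moment => s _ /=; case: eqP => [->//|_]; case: eqP => [->|//].
  by rewrite cy.
have := moment_exchange haar j [eta c with x |-> q] (c x) q.
rewrite (bigD1 y) /= ?yj ?(negbTE yx) ?cy ?eqxx // big1 ?addr0; last first.
  move=> s /andP[/andP[_]]; have [_|sx] := eqVneq s x; first by rewrite (negbTE qx).
  by rewrite fibre (negbTE sx) /= => ->.
rewrite (bigD1 x) /= ?xj ?eqxx //.
have -> : moment j [eta [eta c with x |-> q] with x |-> c x] = moment j c.
  by apply: eq_moment => s _ /=; case: eqP => // ->.
move=> exch; transitivity (moment j [eta [eta c with x |-> q] with y |-> q]).
  by apply: eq_moment => s _ /=; case: eqP => // _; case: eqP.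
rewrite exch; congr (_ + _); apply: eq_big => [a|a /andP[/andP[aj]]].
  have [->|_] := eqVneq a x; first by rewrite !andbF eqxx andbF.
  by rewrite andbT; case: eqP => [->|_]; rewrite ?qx ?andbF //.
have [//|ax] := eqVneq a x; move=> /eqP ca _; apply: eq_moment => s _ /=.
case: tpermP => [->|->|/eqP/negbTE -> /eqP/negbTE -> //]; rewrite ?eqxx //.
by rewrite eq_sym (negbTE ax) ca.
Qed.

Lemma sum_moment_recolour j c (x y : point k) :
  (x < 2 * j)%N -> (y < 2 * j)%N -> partner c x y ->
  \sum_q moment j [eta c with x |-> q, y |-> q] = N%:R * moment j c +
    \sum_(a : point k | (a < 2 * j)%N && (c a != c x)) moment j (c \o tperm a x).
Proof.
move=> xj yj pxy; under eq_bigr do rewrite (moment_recolour _ xj yj pxy).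
rewrite big_split /= sumr_const card_ord mulr_natl; congr (_ + _).
rewrite [RHS](partition_big c predT) //=; apply: eq_bigr => q _.
by apply: eq_bigl => a; rewrite andbA.
Qed.

Lemma sum_moment_contract_block (j : 'I_k) c :
  \sum_q moment j.+1 [eta c with ofst j |-> q, osnd j |-> q] = M%:R * moment j c.
Proof.
have bprod q := bounded_mfun_entry_prod R M j.+1 [eta c with ofst j |-> q, osnd j |-> q].
rewrite -(bounded_Rintegral_sum (haar_ae haar)) //.
rewrite -(bounded_RintegralZl (haar_ae haar)); last exact: bounded_mfun_entry_prod.
apply: (ae_eq_Rintegral (haar_ae haar)).
- exact: bounded_mfun_sum.
- exact: bounded_mfunM (bounded_mfun_cst _ _) (bounded_mfun_entry_prod _ _ _ _).
move=> A [_ [AA <-]]; rewrite -(mxtrace_idempotent AA) /mxtrace mulr_suml.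
apply: eq_bigr => q _; rewrite entry_prodS /= !eqxx osnd_neq_ofst; congr (_ * _).
congr (_ A); apply: eq_entry_prod => s sj /=.
by rewrite !(ltn_point_neq sj).
Qed.

Lemma sum_moment_contract_earlier (j : 'I_k) c (u : point k) : (u < 2 * j)%N ->
  \sum_q moment j.+1 [eta c with ofst j |-> q, u |-> q] =
  moment j [eta c with u |-> c (osnd j)].
Proof.
move=> uj.
have bprod q := bounded_mfun_entry_prod R M j.+1 [eta c with ofst j |-> q, u |-> q].
rewrite -(bounded_Rintegral_sum (haar_ae haar)) //; apply: (ae_eq_Rintegral (haar_ae haar)).
- exact: bounded_mfun_sum.
- exact: bounded_mfun_entry_prod.
move=> A [AT [AA _]]; have [r [others prodE]] := entry_prod_update c AT uj.
rewrite prodE -[in RHS]AA mxE mulr_suml; apply: eq_bigr => q _.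
rewrite entry_prodS /= eqxx osnd_neq_ofst [osnd j == u]eq_sym (ltn_point_neq uj).
rewrite (symmetric_mxE AT q) -mulrA -prodE; congr (_ * _ A).
by apply: eq_entry_prod => s sj /=; rewrite (ltn_point_neq sj).
Qed.

Lemma moment_transpose_block j (l : 'I_k) c :
  moment j (c \o tperm (osnd l) (ofst l)) = moment j c.
Proof.
apply: (ae_eq_Rintegral (haar_ae haar)); [exact: bounded_mfun_entry_prod..|] => A [AT _].
apply: eq_bigr => i _ /=; have [->|il] := eqVneq i l.
  by rewrite tpermL tpermR (symmetric_mxE AT).
by rewrite !tpermD // ?ofst_neq_osnd ?osnd_neq_ofst //
  ?(inj_eq (@ofst_inj _)) ?(inj_eq (@osnd_inj _)) // eq_sym.
Qed.

Lemma moment_recursion_matched (j : 'I_k) c : partner c (ofst j) (osnd j) ->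
  N%:R * moment j.+1 c + jucys_murphy j (moment j.+1) c = M%:R * moment j c.
Proof.
move=> p; rewrite -sum_moment_contract_block (sum_moment_recolour _ _ p) /=; [|lia|lia].
congr (_ + _); apply: eq_bigl => a; case: p => _ ->.
by rewrite -!(inj_eq val_inj) /=; lia.
Qed.

(* The transposition with the partner u of [ofst j] fixes c; it stands in for
   the one with [osnd j], which only exchanges the two indices of one entry. *)
Lemma moment_recursion_unmatched (j : 'I_k) c (u : point k) :
  partner c (ofst j) u -> (u < 2 * j)%N ->
  N%:R * moment j.+1 c + jucys_murphy j (moment j.+1) c =
  moment j [eta c with u |-> c (osnd j)].
Proof.
move=> pu uj; rewrite -sum_moment_contract_earlier //.
rewrite (sum_moment_recolour _ _ pu) /=; [|lia|lia].
have [_ fibre] := pu; congr (_ + _); rewrite /jucys_murphy (bigD1 u uj) /=.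
rewrite [RHS](bigD1 (osnd j)) /=; last by rewrite fibre -!(inj_eq val_inj) /=; lia.
congr (_ + _); last first.
  by apply: eq_bigl => a; rewrite fibre -!(inj_eq val_inj) /=; lia.
rewrite moment_transpose_block; apply: eq_moment => s _ /=.
by case: tpermP => [->|->|//]; rewrite (partner_colour pu).
Qed.

Definition matched_moment (j : nat) c : R := if matched_from j c then moment j c else 0.

Lemma jucys_murphy_matched_moment0 (j : 'I_k) c : partner c (ofst j) (osnd j) ->
  jucys_murphy j (matched_moment j) c = 0.
Proof.
move=> p; apply: big1 => a aj; rewrite /matched_moment matched_from_tperm_ofst //.
have [_ fibre] := p; by rewrite (partner_colour p) fibre !(ltn_point_neq aj).
Qed.

Lemma jucys_murphy_matched_moment (j : 'I_k) c (u v : point k) :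
  matched_from j.+1 c -> partner c (ofst j) u -> partner c (osnd j) v ->
  (u < 2 * j)%N -> (v < 2 * j)%N ->
  jucys_murphy j (matched_moment j) c = moment j [eta c with u |-> c (osnd j)].
Proof.
move=> matched_c [_ fibre_u] pv uj vj; have [_ fibre_v] := pv; have cv := partner_colour pv.
rewrite /jucys_murphy (bigD1 v vj) big1 /= ?addr0 => [|a /andP[aj av]]; last first.
  rewrite /matched_moment matched_from_tperm_ofst // fibre_v (negbTE av).
  by rewrite (ltn_point_neq aj).
rewrite /matched_moment matched_from_tperm_ofst // cv eqxx matched_c /=.
transitivity (moment j [eta c with v |-> c (ofst j)]).
  apply: eq_moment => s sj /=; have [s_ofst _] := ltn_point_neq sj.
  by case: tpermP s_ofst => [->|->|/eqP/negbTE->]; rewrite ?eqxx.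
have := moment_exchange haar j c (c (ofst j)) (c (osnd j)).
rewrite (bigD1 u) /= ?uj ?fibre_u ?eqxx ?orbT // big1 ?addr0; last first.
  by move=> s /andP[/andP[sj]]; rewrite fibre_u (ltn_point_neq sj) /= => ->.
rewrite (bigD1 v) /= ?vj ?fibre_v ?eqxx ?orbT // big1 ?addr0 // => s /andP[/andP[sj]].
by rewrite fibre_v (ltn_point_neq sj) /= => ->.
Qed.

Lemma matched_moment_recursion (j : 'I_k) c : pairing c ->
  N%:R * matched_moment j.+1 c + jucys_murphy j (matched_moment j.+1) c =
  M%:R * matched_moment j c + jucys_murphy j (matched_moment j) c.
Proof.
move=> pc; have [matched_c|/negbTE unmatched_c] := boolP (matched_from j.+1 c); last first.
  rewrite /matched_moment matched_fromS unmatched_c andbF !mulr0.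
  rewrite /jucys_murphy !big1 // => a aj.
    by rewrite matched_from_tperm_ofst // unmatched_c andbF.
  by rewrite matched_from_tperm ?unmatched_c //=; lia.
have -> : jucys_murphy j (matched_moment j.+1) c = jucys_murphy j (moment j.+1) c.
  apply: eq_bigr => a aj; rewrite /matched_moment matched_from_tperm ?matched_c //=; lia.
have [u pu] := pc (ofst j); have [v pv] := pc (osnd j).
have [cj|cj] := eqVneq (c (ofst j)) (c (osnd j)).
  have [_ /(_ (osnd j))] := pu; rewrite -cj eqxx osnd_neq_ofst => /esym/eqP eu.
  rewrite -eu in pu; rewrite {1 2}/matched_moment matched_c matched_fromS cj eqxx matched_c.
  by rewrite moment_recursion_matched // jucys_murphy_matched_moment0 // addr0.
have uj := partner_ofst_lt matched_c cj pu; have vj := partner_osnd_lt matched_c cj pv.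
rewrite {1 2}/matched_moment matched_c matched_fromS (negbTE cj) mulr0 add0r.
rewrite (moment_recursion_unmatched pu uj).
by rewrite (jucys_murphy_matched_moment matched_c pu pv uj vj).
Qed.

End MomentRecursion.

Lemma big_tuple_rcons (V : nmodType) (T : finType) (r : nat) (P : pred (seq T))
    (F : seq T -> V) :
  \sum_(s : r.+1.-tuple T | P s) F s =
  \sum_(x : T) \sum_(s : r.-tuple T | P (rcons s x)) F (rcons s x).
Proof.
rewrite pair_big_dep /=.
pose f (z : T * r.-tuple T) : r.+1.-tuple T := [tuple of rcons z.2 z.1].
have f_inj : injective f.
  by move=> [x s] [x' s'] /(congr1 val) /= /rcons_inj[/val_inj-> ->].
rewrite (reindex f) //=; apply/onW_bij/(inj_card_bij f_inj).
by rewrite card_prod !card_tuple expnS.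
Qed.

Section MonotoneSums.

Variable k : nat.
Implicit Types (ab : transposition k) (s : seq (transposition k)).

Definition prod_transp s : {perm point k} := (\prod_(ab <- s) transp ab)%g.

Lemma prod_transp_rcons s ab : prod_transp (rcons s ab) = (prod_transp s * transp ab)%g.
Proof. by rewrite /prod_transp -cats1 big_cat big_seq1. Qed.

Definition monotone_below (j : nat) s : bool :=
  [&& all (fun ab => ab.1 < ab.2)%N s,
      sorted leq (map (fun ab => nat_of_ord ab.2) s),
      all (fun ab => odd (nat_of_ord ab.2).+1) s &
      all (fun ab => ab.2 < 2 * j)%N s].

Lemma monotone_belowS j s : monotone_below j s =
  monotone_below j.+1 s && all (fun ab => ab.2 < 2 * j)%N s.
Proof.
rewrite /monotone_below -!andbA; do 3 congr (_ && _).
by rewrite -all_predI; apply: eq_all => ab /=; lia.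
Qed.

Lemma monotone_below_rcons j s ab : monotone_below j (rcons s ab) =
  [&& (ab.1 < ab.2)%N, odd (nat_of_ord ab.2).+1, (ab.2 < 2 * j)%N,
      all (fun ab' => ab'.2 <= ab.2)%N s & monotone_below j s].
Proof.
rewrite /monotone_below !all_rcons map_rcons !sorted_pairwise; try exact: leq_trans.
rewrite pairwise_rcons all_map /=.
by apply/and4P/and5P => [[/andP[-> ->] /andP[-> ->] /andP[-> ->] /andP[-> ->]]|
  [-> -> -> -> /and4P[-> -> -> ->]]].
Qed.

Lemma monotone_below_rcons_ofst (j : 'I_k) s (a : point k) :
  monotone_below j.+1 (rcons s (a, ofst j)) = (a < 2 * j)%N && monotone_below j.+1 s.
Proof.
rewrite monotone_below_rcons /=; have -> : ~~ odd (2 * j) by lia.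
have -> : (2 * j < 2 * j.+1)%N by lia.
rewrite /=; congr (_ && _); rewrite andb_idl // => /and4P[_ _ odd_s below_s].
apply/allP => ab sab; have := allP odd_s ab sab; have := allP below_s ab sab.
by rewrite /=; lia.
Qed.

Lemma monotone_below_rcons_neq (j : 'I_k) s ab : ab.2 != ofst j ->
  monotone_below j.+1 (rcons s ab) = monotone_below j (rcons s ab).
Proof.
rewrite -(inj_eq val_inj) /= => abj; rewrite [RHS]monotone_belowS all_rcons andb_idr //.
rewrite monotone_below_rcons => /and5P[_ odd_b b_lt le_b _].
have bj : (ab.2 < 2 * j)%N by lia.
by rewrite bj; apply: sub_all le_b => ab' /= /leq_ltn_trans; apply.
Qed.

Lemma ofst_notin_monotone_below (j : 'I_k) s : monotone_below j.+1 s ->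
  (ofst j \notin map snd s) = monotone_below j s.
Proof.
move=> mono_s; rewrite monotone_belowS mono_s /=.
case/and4P: mono_s => _ _ odd_s below_s; apply/idP/allP => [notin ab sab|below].
  have : ab.2 != ofst j by apply: contraNneq notin => <-; exact: map_f.
  have := allP odd_s ab sab; have := allP below_s ab sab.
  by rewrite -(inj_eq val_inj) /=; lia.
by apply/mapP => -[ab /below /= + abj]; rewrite -abj ltnn.
Qed.

Lemma hive_rcons s ab : hive (rcons s ab) = (hive s + (ab.2 \notin map snd s))%N.
Proof.
rewrite /hive map_rcons (perm_size (perm_undup (_ : _ =i ab.2 :: map snd s))) /=.
  by case: ifP => _; rewrite /= ?addn0 ?addn1.
by move=> x; rewrite mem_rcons.
Qed.

Variables (R : realType) (T : eqType) (t : R).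
Implicit Types c : point k -> T.

Definition monotone_sum (j r : nat) c : R :=
  \sum_(s : r.-tuple (transposition k) |
    monotone_below j s && matched_from 0 (c \o prod_transp s)) t ^+ hive s.

Lemma monotone_sum0 j c : monotone_sum j 0 c = (matched_from 0 c)%:R.
Proof.
rewrite /monotone_sum big_mkcond (bigD1 [tuple]) //= big1 ?addr0 => [|s]; last first.
  by rewrite tuple0.
have -> : c \o prod_transp [::] = c.
  by apply/funext => s; rewrite /prod_transp big_nil /= perm1.
by case: ifP.
Qed.

Lemma monotone_sum_below0 r c : monotone_sum 0 r.+1 c = 0.
Proof.
by rewrite /monotone_sum big_pred0 // => s; rewrite (tuple_eta s) /monotone_below /= !andbF.
Qed.

Lemma monotone_sum_rcons j r c : monotone_sum j r.+1 c =
  \sum_ab \sum_(s : r.-tuple (transposition k) |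
    monotone_below j (rcons s ab) && matched_from 0 ((c \o transp ab) \o prod_transp s))
    t ^+ hive (rcons s ab).
Proof.
rewrite /monotone_sum (big_tuple_rcons r
  (fun s => monotone_below j s && matched_from 0 (c \o prod_transp s))
  (fun s => t ^+ hive s)).
apply: eq_bigr => ab _; apply: eq_bigl => s; rewrite prod_transp_rcons.
by congr (_ && matched_from _ _); apply/funext => p; rewrite /= permM.
Qed.

(* The value 2j+1 of b is new, and so contributes a factor t = 1 + (t - 1), exactly
   when the remaining transpositions stay below 2j+1. *)
Lemma monotone_sum_rcons_ofst (j : 'I_k) r c (a : point k) : (a < 2 * j)%N ->
  \sum_(s : r.-tuple (transposition k) |
    monotone_below j.+1 (rcons s (a, ofst j)) && matched_from 0 (c \o prod_transp s))
    t ^+ hive (rcons s (a, ofst j)) =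
  monotone_sum j.+1 r c + (t - 1) * monotone_sum j r c.
Proof.
move=> aj; rewrite /monotone_sum mulr_sumr.
rewrite big_mkcond [X in X + _]big_mkcond [X in _ + X]big_mkcond -big_split /=.
apply: eq_bigr => s _; rewrite monotone_below_rcons_ofst aj /=.
have [mono_s|/negbTE nmono] := boolP (monotone_below j.+1 s); last first.
  by rewrite monotone_belowS nmono /= addr0.
rewrite hive_rcons ofst_notin_monotone_below //.
case: (matched_from _ _); rewrite ?andbF ?addr0 //=.
by case: (monotone_below j s) => /=; rewrite ?addn0 ?addn1 ?addr0 //;
  rewrite exprS mulrBl mul1r addrC subrK.
Qed.

Lemma monotone_sum_recursion (j : 'I_k) r c :
  monotone_sum j.+1 r.+1 c = monotone_sum j r.+1 c +
    (jucys_murphy j (monotone_sum j.+1 r) c +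
     (t - 1) * jucys_murphy j (monotone_sum j r) c).
Proof.
rewrite !monotone_sum_rcons (bigID (fun ab => ab.2 == ofst j)) /= addrC; congr (_ + _).
  rewrite big_mkcond; apply: eq_bigr => ab _; case: eqP => [abj|/eqP abj] /=.
    by rewrite big_pred0 // => s; rewrite monotone_below_rcons abj /= ltnn !andbF.
  by apply: eq_bigl => s; rewrite monotone_below_rcons_neq.
rewrite /jucys_murphy mulr_sumr -big_split /=.
rewrite [RHS]big_mkcond.
transitivity (\sum_(a : point k) \sum_(b | b == ofst j)
  \sum_(s : r.-tuple (transposition k) |
    monotone_below j.+1 (rcons s (a, b)) &&
      matched_from 0 ((c \o transp (a, b)) \o prod_transp s))
    t ^+ hive (rcons s (a, b))).
  by rewrite [RHS]pair_big_dep /=; apply: eq_big => [[]|[]].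
apply: eq_bigr => a _; rewrite big_pred1_eq; case: ifP => aj.
  exact: monotone_sum_rcons_ofst.
by rewrite big_pred0 // => s; rewrite monotone_below_rcons_ofst aj.
Qed.

End MonotoneSums.

Section PairPartitions.

Variables (k N : nat).
Implicit Types (c : point k -> 'I_N) (m : {set {set point k}}).

Lemma adaptedP m c :
  reflect (forall a b, a != b -> (c a == c b) = ([set a; b]%SET \in m)) (adapted m c).
Proof.
apply: (iffP forallP) => [cm a b ab|cm a].
  exact: (eqP (implyP (forallP (cm a) b) ab)).
by apply/forallP => b; apply/implyP => ab; rewrite cm.
Qed.

Lemma pair_partition_card m B : pair_partition m -> B \in m -> #|B| = 2.
Proof. by case/andP=> _ /forallP/(_ B)/implyP mB /mB /eqP. Qed.

Lemma pair_partition_act m (u : {perm point k}) :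
  pair_partition m -> pair_partition (pp_act u m).
Proof.
move=> pm; have /andP[part_m _] := pm; apply/andP; split.
  have <- : (u @: [set: point k] = [set: point k])%SET.
    by apply/eqP; rewrite eqEcard finset.subsetT card_imset //=; exact: perm_inj.
  by rewrite imset_partition //; exact: perm_inj.
apply/forallP => B; apply/implyP => /imsetP[C Cm ->].
by rewrite card_imset ?(pair_partition_card pm Cm) //; exact: perm_inj.
Qed.

Lemma adapted_act m c (u : {perm point k}) :
  adapted m c -> adapted (pp_act u m) (c \o (u^-1)%g).
Proof.
move=> /adaptedP cm; apply/adaptedP => a b ab.
have -> : [set a; b]%SET = [set u z | z in [set (u^-1)%g a; (u^-1)%g b]%SET]%SET.
  by rewrite imsetU1 imset_set1 !permKV.
rewrite (mem_imset _ _ (imset_inj (@perm_inj _ u))).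
by rewrite /= cm // (inj_eq perm_inj).
Qed.

Lemma act_seqE (s : seq (transposition k)) m :
  act_seq s m = pp_act (prod_transp s)^-1 m.
Proof.
have actM u v m' : pp_act (u * v)%g m' = pp_act v (pp_act u m').
  rewrite /pp_act -imset_comp; apply: eq_imset => B /=.
  by rewrite -imset_comp; apply: eq_imset => a; rewrite /= permM.
elim: s => [|ab s IH] /=.
  rewrite /prod_transp big_nil invg1 /pp_act -[LHS]imset_id; apply: eq_imset => B.
  by rewrite -[LHS]imset_id; apply: eq_imset => a; rewrite perm1.
by rewrite IH -actM /prod_transp big_cons invMg tpermV.
Qed.

Lemma pairing_adapted m c : pair_partition m -> adapted m c -> pairing c.
Proof.
move=> pm /adaptedP cm a; have /andP[part_m _] := pm.
have a_cover : a \in finset.cover m by rewrite (finset.cover_partition part_m) inE.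
have Bm := finset.pblock_mem a_cover.
have aB : a \in finset.pblock m a by rewrite finset.mem_pblock.
have /eqP := pair_partition_card pm Bm.
rewrite (cardsD1 a) aB add1n eqSS => /cards1P[b eB].
have [ba bB] : b != a /\ b \in finset.pblock m a.
  by have := set11 b; rewrite -eB !inE => /andP[].
have BE : finset.pblock m a = [set a; b]%SET by rewrite -eB finset.setD1K.
exists b; split=> // s; have [->|sa] := eqVneq s a; first by rewrite eqxx.
rewrite cm //=; apply/idP/eqP => [sm|->]; last by rewrite finset.setUC -BE.
have := finset.def_pblock (finset.partition_trivIset part_m) sm (set22 s a).
by rewrite BE => /setP/(_ s); rewrite !inE eqxx (negbTE sa) => /eqP.
Qed.

Lemma card_pair_partition m : pair_partition m -> #|m| = k.
Proof.
move=> pm; have /andP[part_m _] := pm.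
have := finset.card_uniform_partition (fun B => @pair_partition_card m B pm) part_m.
by rewrite cardsT card_ord; lia.
Qed.

Lemma card_e_part : #|e_part k| = k.
Proof.
rewrite card_imset ?card_ord // => l l' /setP/(_ (ofst l)); rewrite !inE.
by rewrite !ofst_neq_osnd !orbF eqxx => /esym/eqP/ofst_inj.
Qed.

Lemma adapted_e_part m c : pair_partition m -> adapted m c ->
  (m == e_part k) = matched_from 0 c.
Proof.
move=> pm /adaptedP cm.
have blockE l : (c (ofst l) == c (osnd l)) = ([set ofst l; osnd l]%SET \in m).
  by rewrite cm // ofst_neq_osnd.
rewrite eq_sym eqEcard card_pair_partition // card_e_part leqnn andbT.
apply/fintype.subsetP/matched_fromP => [e_m l _|matched_c B /imsetP[l _ ->]].
  by apply/eqP; rewrite blockE e_m //; apply/imsetP; exists l.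
by rewrite -blockE matched_c.
Qed.

Lemma heval_monotone_sum (R : realType) (t : R) (r : nat) m c :
  pair_partition m -> adapted m c -> heval r m t = monotone_sum t k r c.
Proof.
move=> pm cm; rewrite /heval /hpoly rmorph_sum horner_sum.
apply: eq_big => [s|s _]; last by rewrite rmorphXn /= map_polyX hornerXn.
rewrite /monotone_fact /monotone_below act_seqE.
rewrite (adapted_e_part (pair_partition_act _ pm) (adapted_act _ cm)) invgK.
rewrite -!andbA; do 3 congr (_ && _).
by have -> : all (fun ab : transposition k => (ab.2 < 2 * k)%N) s by apply/allP.
Qed.

End PairPartitions.

Section Contraction.

Variable R : realType.

Lemma cvg0_sum (I : finType) (P : pred I) (u : nat -> I -> R) :
  (forall i, u n i @[n --> \oo] --> 0) -> \sum_(i | P i) u n i @[n --> \oo] --> 0.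
Proof.
move=> u_cvg0; have := @fct_sumE I nat R (index_enum I) P (fun i n => u n i) => /= <-.
elim/big_ind: _ => [|f g f_cvg0 g_cvg0|i _]; [exact: cvg_cst | | exact: u_cvg0].
by rewrite -[X in _ --> X]addr0; exact: cvgD.
Qed.

Lemma contraction_cvg0 (q : R) (u v : R^nat) : 0 <= q < 1 -> (forall n, 0 <= u n) ->
  (forall n, u n.+1 <= q * u n + v n) -> v n @[n --> \oo] --> 0 -> u n @[n --> \oo] --> 0.
Proof.
move=> /andP[q_ge0 q_lt1] u_ge0 u_rec v_cvg0; apply/cvgr0Pnorm_le => eps eps_gt0.
have delta_gt0 : 0 < eps / 2 * (1 - q) by rewrite mulr_gt0 ?divr_gt0 ?subr_gt0.
have /cvgr0Pnorm_le/(_ _ delta_gt0)[n0 _ v_small] := v_cvg0.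
pose C := `|u n0 - eps / 2|.
have excess i : u (n0 + i)%N - eps / 2 <= C * q ^+ i.
  elim: i => [|i IH]; first by rewrite addn0 expr0 mulr1 ler_norm.
  rewrite addnS exprS mulrCA; apply: le_trans (ler_wpM2l q_ge0 IH).
  have := u_rec (n0 + i)%N.
  by have := le_trans (ler_norm _) (v_small (n0 + i)%N (leq_addr _ _)); lra.
have : C * q ^+ i @[i --> \oo] --> 0 by apply: cvg_geometric; rewrite ger0_norm.
move=> /cvgr0Pnorm_le/(_ _ (divr_gt0 eps_gt0 (ltr0n R 2)))[i0 _ geo_small].
exists (n0 + i0)%N => // n /= n_ge; rewrite ger0_norm ?u_ge0 //.
have -> : n = (n0 + (n - n0))%N by lia.
have i0_le : (i0 <= n - n0)%N by lia.
by have := excess (n - n0)%N; have := le_trans (ler_norm _) (geo_small _ i0_le); lra.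
Qed.

Lemma contraction_family_cvg0 (I : finType) (q : R) (u v : nat -> I -> R) : 0 <= q < 1 ->
  (forall n i, `|u n.+1 i| <= q * \big[Num.max/0]_l `|u n l| + v n i) ->
  (forall i, v n i @[n --> \oo] --> 0) -> forall i, u n i @[n --> \oo] --> 0.
Proof.
move=> q01 u_rec v_cvg0 i; have /andP[q_ge0 _] := q01.
pose U n := \big[Num.max/0]_l `|u n l|.
have U_ge0 n : 0 <= U n by exact: bigmax_ge_id.
suff U_cvg0 : U n @[n --> \oo] --> 0.
  apply/norm_cvg0P; apply: (squeeze_cvgr _ (cvg_cst 0) U_cvg0).
  by apply: nearW => n; rewrite normr_ge0 le_bigmax.
apply: (contraction_cvg0 (v := fun n => \sum_l `|v n l|) q01 U_ge0) => [n|].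
  apply: bigmax_le => [|l _]; first by rewrite addr_ge0 ?mulr_ge0 ?sumr_ge0.
  apply: le_trans (u_rec n l) _; rewrite lerD2l (le_trans (ler_norm _)) //.
  by rewrite (bigD1 l) //= lerDl sumr_ge0.
by apply: cvg0_sum => l; exact/norm_cvg0P/v_cvg0.
Qed.

End Contraction.

Section LargeNExpansion.

Variables (R : realType) (k M N : nat) (mu : probability (MxSpace R N) R) (t : R).
Hypothesis haar : haar_A M mu.
Hypotheses (M_gt0 : (0 < M)%N) (k2_lt : (2 * k < N)%N) (tE : t = 1 - N%:R / M%:R).
Implicit Types c : point k -> 'I_N.

Local Notation x := (- (N%:R : R)^-1).

Definition scaled_moment (j : nat) c : R := (1 - t) ^+ j * matched_moment mu j c.

Definition monotone_partial_sum (j n : nat) c : R :=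
  \sum_(0 <= r < n) monotone_sum t j r c * x ^+ r.

Lemma scaled_moment_recursion (j : 'I_k) c : pairing c ->
  scaled_moment j.+1 c = scaled_moment j c +
  x * (jucys_murphy j (scaled_moment j.+1) c +
       (t - 1) * jucys_murphy j (scaled_moment j) c).
Proof.
move=> pc; have N_neq0 : (N%:R : R) != 0 by rewrite pnatr_eq0; lia.
have M_neq0 : (M%:R : R) != 0 by rewrite pnatr_eq0; lia.
have := matched_moment_recursion haar j pc.
rewrite {3 4}/jucys_murphy /scaled_moment -!mulr_sumr -!/(jucys_murphy _ _ _).
set W := matched_moment mu j.+1 c; set W0 := matched_moment mu j c.
move: (jucys_murphy _ _ _) (jucys_murphy _ _ _) => J0 J rec.
have -> : W = (M%:R * W0 + J0 - J) / N%:R by rewrite -rec addrK mulrAC divff // mul1r.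
by rewrite exprS tE; move: (_ ^+ j) => w; field; rewrite N_neq0 M_neq0.
Qed.

Lemma monotone_partial_sum_recursion (j : 'I_k) n c :
  monotone_partial_sum j.+1 n.+1 c = monotone_partial_sum j n.+1 c +
  x * (jucys_murphy j (monotone_partial_sum j.+1 n) c +
       (t - 1) * jucys_murphy j (monotone_partial_sum j n) c).
Proof.
have jucys_murphy_sum i : jucys_murphy j (monotone_partial_sum i n) c =
    \sum_(0 <= r < n) jucys_murphy j (monotone_sum t i r) c * x ^+ r.
  by rewrite /jucys_murphy exchange_big; apply: eq_bigr => r _; rewrite mulr_suml.
rewrite !jucys_murphy_sum /monotone_partial_sum !big_nat_recl // !monotone_sum0 -addrA.
congr (_ + _); rewrite mulr_sumr -big_split mulr_sumr -big_split.
by apply: eq_bigr => r _; rewrite /= monotone_sum_recursion exprS; ring.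
Qed.

Definition expansion_error (j n : nat) c : R :=
  monotone_partial_sum j n c - scaled_moment j c.

Lemma expansion_error_recursion (j : 'I_k) n c : pairing c ->
  expansion_error j.+1 n.+1 c = expansion_error j n.+1 c +
  x * (jucys_murphy j (expansion_error j.+1 n) c +
       (t - 1) * jucys_murphy j (expansion_error j n) c).
Proof.
move=> pc; rewrite {1 2}/expansion_error.
rewrite monotone_partial_sum_recursion scaled_moment_recursion //.
by rewrite /jucys_murphy !sumrB; ring.
Qed.

Lemma expansion_error0_cvg0 c : expansion_error 0 n c @[n --> \oo] --> 0.
Proof.
apply: cvg_near_cst; exists 1%N => // -[//|n] _; apply/eqP.
rewrite /expansion_error /monotone_partial_sum big_nat_recl // big1 => [|r _]; last first.
  by rewrite monotone_sum_below0 mul0r.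
rewrite monotone_sum0 /scaled_moment /matched_moment.
have -> : moment mu 0 c = 1.
  rewrite -[RHS](Rintegral_probability_cst mu); apply: eq_Rintegral => A _.
  by rewrite /entry_prod /entry_monomial big_pred0.
by case: matched_from; rewrite !(expr0, mulr1, mulr0, addr0) subrr.
Qed.

Lemma contraction_factor_lt1 : 0 <= `|x| * (2 * k)%:R < 1.
Proof.
rewrite mulr_ge0 //= normrN ger0_norm ?invr_ge0 // mulrC.
by rewrite ltr_pdivrMr ?mul1r ?ltr_nat ?ltr0n //; lia.
Qed.

(* Only the colourings c o s are related by the recursion, so the permutations s
   index the finite family to which the contraction argument applies. *)
Lemma expansion_error_cvg0 j c : (j <= k)%N -> pairing c ->
  expansion_error j n c @[n --> \oo] --> 0.
Proof.
elim: j c => [|j IH] c jk pc; first exact: expansion_error0_cvg0.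
pose J := Ordinal jk; pose twist a (s : {perm point k}) := (tperm a (ofst J) * s)%g.
have twistE a (s : {perm point k}) : (c \o s) \o tperm a (ofst J) = c \o twist a s.
  by apply/funext => p; rewrite /= permM.
have jucys_murphy_twist_le (f : (point k -> 'I_N) -> R) (s : {perm point k}) :
    `|jucys_murphy J f (c \o s)| <= \sum_a `|f (c \o twist a s)|.
  by under eq_bigr do rewrite -twistE; exact: jucys_murphy_norm_le.
pose u n (s : {perm point k}) := expansion_error j.+1 n (c \o s).
pose e n (s : {perm point k}) := expansion_error j n (c \o s).
have e_cvg0 s : e n s @[n --> \oo] --> 0 by apply: IH (ltnW jk) (pairing_perm _ pc).
pose v n s := `|e n.+1 s| + `|x| * `|t - 1| * \sum_a `|e n (twist a s)|.
have v_cvg0 s : v n s @[n --> \oo] --> 0.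
  rewrite -[X in _ --> X]addr0; apply: cvgD.
    by rewrite (cvg_shiftS (fun n => `|e n s|)); exact/norm_cvg0P/e_cvg0.
  rewrite -[X in _ --> X](mulr0 (`|x| * `|t - 1|)); apply: cvgM; first exact: cvg_cst.
  by apply: cvg0_sum => a; exact/norm_cvg0P/e_cvg0.
have u_rec n s : `|u n.+1 s| <= `|x| * (2 * k)%:R * \big[Num.max/0]_l `|u n l| + v n s.
  rewrite /u (expansion_error_recursion J n (pairing_perm s pc)) /=.
  rewrite /v addrCA (le_trans (ler_normD _ _)) // lerD2l normrM -!mulrA -mulrDr.
  rewrite ler_wpM2l // (le_trans (ler_normD _ _)) // normrM lerD //; last first.
    by rewrite ler_wpM2l // jucys_murphy_twist_le.
  apply: le_trans (jucys_murphy_twist_le _ _) _.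
  rewrite mulr_natl -[X in _ *+ X]card_ord -sumr_const.
  by apply: ler_sum => a _; exact: (le_bigmax _ (fun s' => `|u n s'|)).
have -> : c = c \o (1%g : {perm point k}) by apply/funext => p; rewrite /= perm1.
exact: (contraction_family_cvg0 contraction_factor_lt1 u_rec v_cvg0).
Qed.

End LargeNExpansion.

Theorem mainTheorem4 (R : realType) (k : nat) (m : {set {set 'I_(2*k)}})
  (hm : pair_partition m) (t : R) :
  exists N0 : nat, forall (M N : nat), (0 < M)%N -> (M < N)%N -> (N0 <= N)%N ->
    t = 1 - N%:R / M%:R ->
    forall (i : 'I_(2*k) -> 'I_N), adapted m i ->
    forall mu : probability (MxSpace R N) R, haar_A M mu ->
      mu.-integrable setT (fun A : MxSpace R N => (wg_integrand i A)%:E) /\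
      ((fun n : nat => (1 - t) ^- k *
         \sum_(0 <= r < n) heval r m t * (- (N%:R)^-1) ^+ r) : nat -> R)
        @ \oo --> (Rintegral mu setT (fun A : MxSpace R N => wg_integrand i A) : R).
Proof.
exists (2 * k).+1 => M N M_gt0 _ k2_lt tE i mi mu haar.
have -> : wg_integrand i = entry_prod k i :> (MxSpace R N -> R).
  by apply/funext => A; apply: eq_bigl => l; rewrite /= ltn_ord.
split.
  exact: (bounded_mfun_integrable (haar_ae haar) (bounded_mfun_entry_prod R M k i)).
have t_neq0 : (1 - t) ^+ k != 0.
  by rewrite expf_neq0 // tE opprB addrC subrK mulf_neq0 ?invr_eq0 ?pnatr_eq0; lia.
rewrite -[Rintegral _ _ _](mulKf t_neq0); apply: cvgM; first exact: cvg_cst.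
under eq_fun => n do under eq_bigr => r _ do rewrite (heval_monotone_sum t r hm mi).
have := expansion_error_cvg0 haar M_gt0 k2_lt tE (leqnn k) (pairing_adapted hm mi).
by move=> /subr_cvg0; rewrite /scaled_moment /matched_moment matched_from_all.
Qed.
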